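(* Let $T$ be a tree and let $v \in V(T)$. Then $v$ is an irrelevant vertex of $T$ if and only if $v$ is a $B$-vertex of $T$.
   Context: All graphs are finite and simple. Zero forcing: vertices are colored blue or white; the color change rule says that if a blue vertex $v$ has exactly one white neighbor $u$, then $u$ may be changed to blue ($v$ forces $u$). A set $S\subseteq V(G)$ is a zero forcing set of $G$ if, starting with exactly the vertices of $S$ blue, repeated application of the rule colors all vertices of $G$ blue. A zero forcing set is minimal if the removal of any vertex from it results in a set that is not a zero forcing set. A vertex of $G$ is irrelevant if it is in no minimal zero forcing set of $G$. A pendant (pendent vertex) is a vertex of degree one. A vertex $v$ of a graph has a double pendant if there are two distinct pendants $u,w$ with $N(u)=N(w)=\{v\}$. $B$-vertices: set $G_0=G$. For $i\ge 0$, let $B_i$ be the set of vertices of $G_i$ that have a double pendant in $G_i$, and let $G_{i+1}$ be obtained from $G_i$ by removing all vertices of $B_i$ together with all neighbors of $B_i$ that have degree one in $G_i$. The vertices in $B_0\cup B_1\cup B_2\cup\cdots$ are the $B$-vertices of $G$. *)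

(* Defs.v *)
(* MathComp; a graph on the vertex type V is given by its adjacency relation *)
From mathcomp Require Import all_boot.

Set Implicit Arguments.
Unset Strict Implicit.
Unset Printing Implicit Defensive.

Section Defs.

Variables (V : finType) (e : rel V).

Definition simple_graph : Prop := symmetric e /\ irreflexive e.

(* [ucycle] also holds of the empty sequence and of [:: x; y] for an edge xy,
   hence the size bound *)
Definition acyclic : Prop := forall c : seq V, 2 < size c -> ~ ucycle e c.

Definition connected_graph : Prop :=
  0 < #|V| /\ forall x y : V, connect e x y.

Definition is_tree : Prop := [/\ simple_graph, connected_graph & acyclic].

(* Neighbourhood of [x] in the subgraph induced by [U]; [x] itself is not
   required to belong to [U] *)
Definition nbhd_in (U : {set V}) (x : V) : {set V} := [set y in U | e x y].

Definition nbhd (x : V) : {set V} := nbhd_in [set: V] x.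

(* [B] and [B'] are the sets of blue vertices before and after one force *)
Definition force_step : rel {set V} := fun B B' =>
  [exists v in B, exists u, (nbhd v :\: B == [set u]) && (B' == u |: B)].

Definition zero_forcing (S : {set V}) : bool := connect force_step S [set: V].

Definition minimal_zero_forcing (S : {set V}) : bool :=
  zero_forcing S && [forall x in S, ~~ zero_forcing (S :\ x)].

Definition irrelevant (v : V) : bool :=
  [forall S : {set V}, minimal_zero_forcing S ==> (v \notin S)].

Definition pendant (U : {set V}) (w : V) : bool :=
  (w \in U) && (#|nbhd_in U w| == 1).

Definition double_pendant (U : {set V}) (v : V) : bool :=
  [exists u, exists w, [&& u != w, pendant U u, pendant U w,
     nbhd_in U u == [set v] & nbhd_in U w == [set v]]].

(* B_i, when [U] is the vertex set of G_i *)
Definition B_layer (U : {set V}) : {set V} := [set v in U | double_pendant U v].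

(* Only vertices are ever deleted, so G_i is the subgraph induced by its vertex
   set [B_graph i] *)
Definition B_remove (U : {set V}) : {set V} :=
  U :\: (B_layer U :|: [set w | pendant U w & [exists v in B_layer U, e v w]]).

Definition B_graph (i : nat) : {set V} := iter i B_remove [set: V].

Definition B_vertex (v : V) : Prop := exists i : nat, v \in B_layer (B_graph i).

End Defs.

(* Main.v *)
Require Import Defs.
From mathcomp Require Import all_boot.

Set Implicit Arguments.
Unset Strict Implicit.
Unset Printing Implicit Defensive.

(** A fort is a nonempty vertex set such that no vertex outside it has exactly
    one neighbour in it. A fort that is entirely white stays white, and the
    white set left when no more force is possible is a fort or empty; so the
    zero forcing sets are the transversals of the family of forts
    ([zero_forcing_fortP]), and a vertex is in some minimal transversal if and
    only if it is in some inclusion-minimal fort ([irrelevantPn]). The theorem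
    thus says that, in a tree, the vertices outside all minimal forts are the
    B-vertices.

    A B-vertex v is in no minimal fort F, by induction on its layer i
    ([B_layer_notin_minset_fort]). Let u and w be two pendants of v in G_i. All
    other neighbours of u and w are B-vertices of earlier layers, so outside F.
    If v is in F then so are u and w, for otherwise v would be the only
    neighbour in F of u or of w. But then the part of F in the components of
    T - v that contain u and w is a smaller fort: v sees at least u and w in it,
    and a vertex of these components outside F has the same neighbours in it as
    in F, because by acyclicity only u and w see v there.

    Conversely, two facts about the set B of all B-vertices suffice. Each
    B-vertex has at least two neighbours outside B ([B_set_nbr]: its two
    pendants are never B-vertices themselves). And in T - B no vertex has two
    pendants ([B_set_leaf_uniq]): such pendants would be pendants of the final
    graph of the pruning, whose B-layer is empty. From v outside B, a set F
    disjoint from B is grown greedily ([balanced_exists]): for each vertex x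
    outside F with a single neighbour in F, a second neighbour z of x outside B
    is put into F, with the pendant of z in T - B if there is one. This second
    neighbour exists by the first fact if x is in B; if x is not in B, it exists
    because x is not a pendant of T - B attached to F, such pendants having
    been put in F already. The set grows along a subtree, so the additions never
    interfere, and in the end every vertex of F has at most one neighbour in F
    and every other vertex has none or two. In such a set, membership in a
    subfort propagates between adjacent vertices and between the two neighbours
    of an outside vertex; hence the class of v under these links is a minimal
    fort ([balanced_minset_fort]). *)

(** * Forts and zero forcing *)

Section Forts.

Variables (V : finType) (e : rel V).

Definition fort (F : {set V}) : bool :=
  (F != set0) && [forall x, (x \notin F) ==> (#|nbhd_in e F x| != 1)].

Lemma in_nbhd_in (F : {set V}) x y : (y \in nbhd_in e F x) = (y \in F) && e x y.
Proof. by rewrite inE. Qed.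

(** The form in which the condition is used: an outside vertex that sees F sees
    it twice. *)
Lemma fortP (F : {set V}) :
  reflect (F != set0 /\
           forall x y, x \notin F -> y \in F -> e x y ->
             exists z, [/\ z \in F, z != y & e x z])
          (fort F).
Proof.
apply: (iffP andP) => -[F0 FP]; split=> //.
  move=> x y xF yF xy.
  have: #|nbhd_in e F x| != 1 by have /forallP/(_ x)/implyP/(_ xF) := FP.
  rewrite (cardsD1 y) in_nbhd_in yF xy /= eqSS cards_eq0.
  case/set0Pn=> z; rewrite in_setD1 in_nbhd_in => /and3P[zy zF xz].
  by exists z.
apply/forallP=> x; apply/implyP=> xF; apply/negP=> /cards1P[y Ey].
have: y \in nbhd_in e F x by rewrite Ey set11.
rewrite in_nbhd_in => /andP[yF xy].
have [z [zF zy xz]] := FP x y xF yF xy.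
have: z \in nbhd_in e F x by rewrite in_nbhd_in zF.
by rewrite Ey inE (negPf zy).
Qed.

Lemma force_stepP (B B' : {set V}) :
  reflect (exists x u, [/\ x \in B, nbhd_in e (~: B) x = [set u] & B' = u |: B])
          (force_step e B B').
Proof.
have nbhdD x : nbhd e x :\: B = nbhd_in e (~: B) x.
  by apply/setP=> y; rewrite !inE.
apply: (iffP exists_inP) => [[x xB /existsP[u /andP[/eqP Nx /eqP ->]]] |].
  by exists x, u; rewrite -nbhdD.
case=> x [u [xB Nx ->]]; exists x => //; apply/existsP; exists u.
by rewrite nbhdD Nx !eqxx.
Qed.

Lemma connect_invariant (T : finType) (r : rel T) (P : pred T) a b :
  (forall c d, r c d -> P c -> P d) -> connect r a b -> P a -> P b.
Proof.
move=> rP /connectP[p + ->]; elim: p a => //= c p IHp a /andP[ac cp] Pa.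
exact: IHp cp (rP _ _ ac Pa).
Qed.

(** No force can enter a white fort: the forcing vertex would be outside the
    fort, with exactly one neighbour in it. Conversely the complement of a
    maximal set reachable from S is empty or a fort that misses S. *)
Lemma zero_forcing_fortP (S : {set V}) :
  reflect (forall F, fort F -> F :&: S != set0) (zero_forcing e S).
Proof.
apply: (iffP idP) => [zfS F /fortP[F0 FP] | meetF].
  apply/negP=> /eqP FS.
  have: F :&: [set: V] == set0.
    apply: (connect_invariant (P := fun B => F :&: B == set0) _ zfS); last exact/eqP.
    move=> B B' /force_stepP[x [u [xB Nx ->]]] /eqP FB; apply/eqP/setP=> t.
    rewrite !inE; case tF: (t \in F) => //=.
    have notB s : s \in F -> s \notin B.
      by move=> sF; apply/negP=> sB; have := in_set0 s; rewrite -FB inE sF sB.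
    rewrite (negPf (notB _ tF)) orbF; apply/negP=> /eqP tu; subst u.
    have: t \in nbhd_in e (~: B) x by rewrite Nx set11.
    rewrite !inE => /andP[_ xt].
    have xF : x \notin F by apply/negP=> /notB; rewrite xB.
    have [z [zF zt xz]] := FP x t xF tF xt.
    have: z \in nbhd_in e (~: B) x by rewrite !inE notB.
    by rewrite Nx inE (negPf zt).
  by rewrite setIT (negPf F0).
pose reach := connect (force_step e) S.
have [B /maxsetP[SB maxB] _] : {B | maxset reach B & S \subset B}.
  by apply: maxset_exists; apply: connect0.
suff /eqP CB : ~: B == set0 by move: SB; rewrite -[B]setCK CB setC0.
apply/negPn/negP=> CB0.
have fortCB : fort (~: B).
  rewrite /fort CB0; apply/forallP=> x; apply/implyP; rewrite inE negbK => xB.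
  apply/negP=> /cards1P[u Nx].
  have stepB : force_step e B (u |: B) by apply/force_stepP; exists x, u.
  have uB : u \notin B by have := set11 u; rewrite -Nx !inE => /andP[].
  have := maxB _ (connect_trans SB (connect1 stepB)) (subsetUr _ _).
  by move/setP/(_ u); rewrite !inE eqxx (negPf uB).
have SsubB : S \subset B.
  apply: (connect_invariant (P := fun C : {set V} => S \subset C) _ SB) => //.
  move=> C C' /force_stepP[x [u [_ _ ->]]] SC.
  exact: subset_trans SC (subsetUr _ _).
have /set0Pn[t] := meetF _ fortCB.
by rewrite !inE => /andP[/negP tB /(subsetP SsubB)].
Qed.

(** If S is a minimal transversal and v is in S, some fort meets S only in v, and
    v is also in every fort contained in it. Conversely, if F is a minimal fort
    containing v, then v together with the complement of F is a transversal, and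
    any minimal transversal inside it must meet F, hence contain v. *)
Lemma irrelevantPn v :
  reflect (exists2 F, minset fort F & v \in F) (~~ irrelevant e v).
Proof.
apply: (iffP forallPn) => [[S] | [F minF vF]].
  rewrite negb_imply negbK => /andP[/andP[/zero_forcing_fortP zfS]].
  move=> /forall_inP minS vS; have := minS v vS.
  case exF: [exists F : {set V}, minset fort F && (v \in F)].
    by case/existsP: exF => F /andP[minF vF] _; exists F.
  case/negP; apply/zero_forcing_fortP=> F fF.
  have [F' minF' F'F] := minset_exists fF.
  have /set0Pn[t] := zfS _ (minsetp minF'); rewrite inE => /andP[tF' tS].
  apply/set0Pn; exists t; rewrite !inE (subsetP F'F) // tS andbT.
  apply: contraFneq exF => tv; apply/existsP; exists F'.
  by rewrite minF' -tv.
have zf0 : zero_forcing e (v |: ~: F).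
  apply/zero_forcing_fortP=> E fE; apply/set0Pn.
  have [EF | /subsetPn[t tE tF]] := boolP (E \subset F).
    by exists v; rewrite (minsetinf minF fE EF) !inE vF eqxx.
  by exists t; rewrite !inE tE tF orbT.
have [S minS SF] := minset_exists zf0.
exists S; rewrite negb_imply negbK; apply/andP; split.
  rewrite /minimal_zero_forcing (minsetp minS); apply/forall_inP=> x xS.
  apply/negP=> zfSx; have := setD11 x S.
  by rewrite (minsetinf minS zfSx (subsetDl _ _)) xS.
have /zero_forcing_fortP/(_ F (minsetp minF))/set0Pn[t] := minsetp minS.
rewrite inE => /andP[tF tS]; have := subsetP SF t tS.
by rewrite !inE tF orbF => /eqP <-.
Qed.

End Forts.

(** * Connected sets in a forest *)

Section Forest.

Variables (V : finType) (e : rel V).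
Hypotheses (sym_e : symmetric e) (irr_e : irreflexive e) (acyclic_e : acyclic e).

Definition restr (W : {set V}) : rel V := fun a b => [&& a \in W, b \in W & e a b].

Lemma restr_sym W : symmetric (restr W).
Proof. by move=> a b; rewrite /restr sym_e andbCA. Qed.

Lemma connect_restrS (W W' : {set V}) a b :
  W \subset W' -> connect (restr W) a b -> connect (restr W') a b.
Proof.
move=> /subsetP sWW'; apply: connect_sub => {}a {}b /and3P[aW bW ab].
by apply: connect1; rewrite /restr !sWW'.
Qed.

Definition connected_in (W : {set V}) : Prop :=
  {in W &, forall a b, connect (restr W) a b}.

Lemma connected_in_root (W : {set V}) r :
  {in W, forall a, connect (restr W) r a} -> connected_in W.
Proof.
move=> conn_r a b aW bW; apply: connect_trans (conn_r b bW).
by rewrite (sym_connect_sym (restr_sym W)) conn_r.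
Qed.

Lemma connected_in_union (W W' : {set V}) a b :
  connected_in W -> connected_in W' -> a \in W -> b \in W' -> e a b ->
  connected_in (W :|: W').
Proof.
move=> cW cW' aW bW' ab; apply: (@connected_in_root _ a) => c.
rewrite inE => /orP[cinW | cinW'].
  exact: connect_restrS (subsetUl _ _) (cW _ _ aW cinW).
apply: (@connect_trans _ _ b).
  by apply: connect1; rewrite /restr !inE aW bW' ab orbT.
exact: connect_restrS (subsetUr _ _) (cW' _ _ bW' cinW').
Qed.

(** Otherwise a simple path from y to z avoiding x closes up to a cycle through
    x. *)
Lemma nbrs_connected_avoiding x y z :
  e x y -> e x z -> connect (restr (~: [set x])) y z -> y = z.
Proof.
move=> xy xz /connectP[p0 yp0 zE].
case/shortenP: yp0 zE => p yp uniq_p _ zE; apply/eqP/negPn/negP=> yz.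
have p_gt0 : 0 < size p by case: (p) zE yz => //= ->; rewrite eqxx.
have xnotin : x \notin y :: p.
  have: all (fun t => t != x) p.
    elim: (p) (y) yp => //= t q IHq s /andP[/and3P[_ + _] /IHq ->].
    by rewrite !inE andbT.
  rewrite inE negb_or => /allP px; apply/andP; split.
    by apply/eqP=> xyE; rewrite xyE irr_e in xy.
  by apply/negP=> /px; rewrite eqxx.
apply: (acyclic_e (c := x :: y :: p)); first by rewrite /= !ltnS.
rewrite /ucycle cons_uniq xnotin uniq_p !andbT.
rewrite /= rcons_path xy -zE sym_e xz andbT.
by apply: sub_path yp => s t /and3P[].
Qed.

Lemma connected_in_nbr (W : {set V}) x y z :
  connected_in W -> x \notin W -> y \in W -> z \in W -> e x y -> e x z -> y = z.
Proof.
move=> cW xW yW zW xy xz; apply: nbrs_connected_avoiding xy xz _.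
apply: connect_restrS (cW _ _ yW zW).
by apply/subsetP=> t tW; rewrite !inE; apply: contraNneq xW => <-.
Qed.

(** * Pruned layers *)

Lemma B_graph_antitone i j : i <= j -> B_graph e j \subset B_graph e i.
Proof.
move=> /subnK <-; elim: (j - i) => //= k IHk.
exact: subset_trans (subsetDl _ _) IHk.
Qed.

Lemma B_layer_removed i x : x \in B_layer e (B_graph e i) -> x \notin B_graph e i.+1.
Proof.
by move=> xL; rewrite /B_graph iterS -/(B_graph e i) in_setD in_setU xL.
Qed.

Lemma B_layer_double_pendant (U : {set V}) b :
  b \in B_layer e U ->
  exists u w, [/\ u != w, u \in U, w \in U, nbhd_in e U u = [set b]
                 & nbhd_in e U w = [set b]].
Proof.
rewrite inE => /andP[_ /existsP[u /existsP[w]]].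
case/and5P=> uw /andP[uU _] /andP[wU _] /eqP Nu /eqP Nw.
by exists u, w.
Qed.

Lemma removedP j x :
  x \notin B_graph e j ->
  exists2 i, i < j & x \in B_layer e (B_graph e i) \/
    x \in B_graph e i /\
    exists2 b, b \in B_layer e (B_graph e i) & nbhd_in e (B_graph e i) x = [set b].
Proof.
elim: j => [|j IHj]; first by rewrite inE.
have [xj | /IHj[i ij xi] _] := boolP (x \in B_graph e j); last first.
  by exists i; rewrite // ltnS ltnW.
rewrite /B_graph iterS -/(B_graph e j) in_setD xj andbT negbK => xR.
exists j => //; case/setUP: xR => [|]; first by left.
rewrite inE => /andP[/andP[_ /cards1P[c Nx]] /exists_inP[b bL bx]]; right.
split=> //; exists b => //; rewrite Nx; congr [set _]; apply/eqP.
rewrite eq_sym -in_set1 -Nx inE sym_e bx andbT.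
by move: bL; rewrite inE => /andP[].
Qed.

(** A neighbour t of x removed as a pendant, while x stays, would have x itself
    as its unique neighbour, that is, as the B-vertex removed together with t. *)
Lemma nbr_of_remaining j x t :
  x \in B_graph e j -> e x t -> t \notin B_graph e j ->
  exists2 i, i < j & t \in B_layer e (B_graph e i).
Proof.
move=> xj xt /removedP[i ij [tL | [ti [b bL Nt]]]]; first by exists i.
have xi : x \in B_graph e i by apply: subsetP (B_graph_antitone (ltnW ij)) _ xj.
have: x \in nbhd_in e (B_graph e i) t by rewrite inE xi sym_e.
rewrite Nt inE => /eqP xb; have /negP[] := B_layer_removed bL.
by rewrite -xb; apply: subsetP (B_graph_antitone ij) _ xj.
Qed.

(** A vertex removed as a pendant had a single neighbour left, a B-vertex; the
    others had been removed before it, so were B-vertices too. *)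
Lemma nbr_of_removed j x t :
  x \notin B_graph e j -> (forall i, i < j -> x \notin B_layer e (B_graph e i)) ->
  e x t -> exists2 i, i < j & t \in B_layer e (B_graph e i).
Proof.
move=> /removedP[i ij [xL | [xi [b bL Nx]]]] xnL xt.
  by rewrite (negPf (xnL i ij)) in xL.
have [ti | tni] := boolP (t \in B_graph e i).
  have: t \in nbhd_in e (B_graph e i) x by rewrite inE ti.
  by rewrite Nx inE => /eqP ->; exists i.
have [k ki tk] := nbr_of_remaining xi xt tni.
by exists k => //; apply: ltn_trans ij.
Qed.

(** * B-vertices are in no minimal fort *)

(** Were v in F, its two pendants would be in F as well, and the part of F lying
    in their components of T - v would be a strictly smaller fort. *)
Lemma B_layer_notin_minset_fort i v F :
  minset (fort e) F -> v \in B_layer e (B_graph e i) -> v \notin F.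
Proof.
move=> minF; elim/ltn_ind: i v => i IHi v vL; apply/negP=> vF.
have /fortP[_ fF] := minsetp minF.
have [u [w [uw uG wG Nu Nw]]] := B_layer_double_pendant vL.
have pend a : a \in B_graph e i -> nbhd_in e (B_graph e i) a = [set v] ->
    e v a /\ a \in F.
  move=> aG Na; have: v \in nbhd_in e (B_graph e i) a by rewrite Na set11.
  rewrite inE => /andP[_ av]; split; first by rewrite sym_e.
  apply/negPn/negP=> aF; have [z [zF zv az]] := fF a v aF vF av.
  have [zG | zG] := boolP (z \in B_graph e i).
    have: z \in nbhd_in e (B_graph e i) a by rewrite inE zG.
    by rewrite Na inE (negPf zv).
  have [j ji zL] := nbr_of_remaining aG az zG.
  by have := IHi j ji z zL; rewrite zF.
have [vu uF] := pend u uG Nu; have [vw wF] := pend w wG Nw.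
(* C is the vertex set of T - v, and D the union of its components at u and w *)
pose C := ~: [set v].
have inC a b : b != v -> (b \in C) by rewrite !inE.
have uv : u != v by apply/eqP=> E; rewrite E irr_e in vu.
have wv : w != v by apply/eqP=> E; rewrite E irr_e in vw.
pose D := [set x | connect (restr C) u x || connect (restr C) w x].
have uD : u \in D by rewrite inE connect0.
have wD : w \in D by rewrite inE connect0 orbT.
have stepD x y : y \in D -> y != v -> x != v -> e x y -> x \in D.
  move=> + yv xv xy; have yx : restr C y x by rewrite /restr !inE yv xv sym_e.
  rewrite !inE => /orP[] /connect_trans/(_ (connect1 yx)) ->; rewrite ?orbT //.
have vD : v \notin D.
  have vnC a : a != v -> ~~ connect (restr C) a v.
    move=> av; apply/negP=> conn_av.
    have: v != v; last by rewrite eqxx.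
    apply: (connect_invariant (P := fun t => t != v) _ conn_av av).
    by move=> c d /and3P[_]; rewrite !inE.
  by rewrite inE negb_or !vnC.
have nbrD x : x \in D -> e v x -> x \in F.
  rewrite inE => /orP[ux | wx] vx.
    by rewrite -(nbrs_connected_avoiding vu vx ux).
  by rewrite -(nbrs_connected_avoiding vw vx wx).
have fFD : fort e (F :&: D).
  apply/fortP; split; first by apply/set0Pn; exists u; rewrite inE uF.
  move=> x y xFD; rewrite !inE -/D => /andP[yF yD] xy.
  have yv : y != v by apply: contraNneq vD => <-; rewrite inE.
  have [xv | xv] := eqVneq x v.
    have [yu | yu] := eqVneq y u.
      by exists w; rewrite !inE wF connect0 orbT xv yu eq_sym.
    by exists u; rewrite !inE uF connect0 xv eq_sym.
  have xD : x \in D by apply: stepD xy; rewrite ?inE.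
  have xF : x \notin F by move: xFD; rewrite in_setI xD andbT.
  have [z [zF zy xz]] := fF x y xF yF xy; exists z; split=> //.
  rewrite in_setI zF; apply: (stepD _ _ xD) => //; last by rewrite sym_e.
  apply/eqP=> zv; rewrite zv sym_e in xz.
  by rewrite (nbrD x xD xz) in xF.
have := minsetinf minF fFD (subsetIl _ _).
by move/setP/(_ v); rewrite in_setI vF (negPf vD).
Qed.

(** * Minimal forts inside balanced sets *)

Definition balanced (F : {set V}) : Prop :=
  forall x, if x \in F then #|nbhd_in e F x| <= 1
            else (#|nbhd_in e F x| == 0) || (#|nbhd_in e F x| == 2).

(** A subfort of F that contains one end of a link [r] contains the other end, so
    the class of v under [r] contains no smaller fort. *)
Lemma balanced_minset_fort F v :
  balanced F -> v \in F -> exists2 C, minset (fort e) C & v \in C.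
Proof.
move=> balF vF.
pose r : rel V := fun a b => [&& a \in F, b \in F &
  e a b || [exists x, [&& x \notin F, e x a & e x b]]].
have sym_r : symmetric r.
  move=> a b; rewrite /r sym_e andbCA; congr [&& _, _ & _ || _].
  by apply: eq_existsb => x; rewrite [e x a && _]andbC.
have out2 x a b c : x \notin F -> a \in F -> b \in F -> c \in F ->
    e x a -> e x b -> e x c -> a != b -> a != c -> b = c.
  move=> xF aF bF cF xa xb xc ab ac; have := balF x; rewrite (negPf xF).
  have aN : a \in nbhd_in e F x by rewrite inE aF.
  case/orP=> [/eqP/cards0_eq N0 | /cards2P[p [q [_ N2]]]].
    by rewrite N0 inE in aN.
  have bN : b \in nbhd_in e F x by rewrite inE bF.
  have cN : c \in nbhd_in e F x by rewrite inE cF.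
  move: aN bN cN ab ac; rewrite N2 !inE.
  by do 3!case/orP=> /eqP ->; rewrite ?eqxx.
pose C := [set a | connect r v a].
have vC : v \in C by rewrite inE.
have CF : C \subset F.
  apply/subsetP=> a; rewrite inE => va.
  by apply: (connect_invariant (P := mem F) _ va) => // c d /and3P[].
have stepC a b : a \in C -> r a b -> b \in C.
  by move=> + ab; rewrite !in_set => va; apply: connect_trans va (connect1 ab).
exists C => //; apply/minsetP; split.
  apply/fortP; split; first by apply/set0Pn; exists v.
  move=> x y xC yC xy; have yF := subsetP CF y yC.
  have [xF | xF] := boolP (x \in F).
    by case/negP: xC; apply: stepC yC _; rewrite /r yF xF sym_e xy.
  have yN : y \in nbhd_in e F x by rewrite inE yF.
  have := balF x; rewrite (negPf xF) cards_eq0.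
  case/orP=> [/eqP N0 | /eqP N2]; first by rewrite N0 inE in yN.
  have: #|nbhd_in e F x :\ y| == 1.
    by rewrite -eqSS -N2 [in X in _ == X](cardsD1 y) yN.
  case/cards1P=> z /setP/(_ z); rewrite !inE eqxx => /and3P[zy zF xz].
  exists z; split=> //; apply: stepC yC _; rewrite /r yF zF; apply/orP; right.
  by apply/existsP; exists x; rewrite xF xy.
move=> G /fortP[/set0Pn[g gG] fG] GC; apply/eqP; rewrite eqEsubset GC /=.
have GF : G \subset F by apply: subset_trans CF.
have clG : closed r (mem G).
  apply: intro_closed; first exact: sym_connect_sym.
  move=> a b /and3P[aF bF] ab aG; apply/negPn/negP=> bG.
  case/orP: ab => [ab | /existsP[x /and3P[xF xa xb]]].
    have ba : e b a by rewrite sym_e.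
    have [z [zG /eqP za bz]] := fG b a bG aG ba; apply: za.
    have := balF b; rewrite bF => /card_le1_eqP; apply; rewrite inE ?aF //.
    by rewrite (subsetP GF).
  have xG : x \notin G by apply: contra xF; apply: subsetP.
  have [z [zG za xz]] := fG x a xG aG xa.
  have ab : a != b by apply: contraNneq bG => <-.
  have zF := subsetP GF z zG.
  suff bz : b = z by rewrite bz zG in bG.
  by apply: (out2 x a); rewrite // eq_sym.
apply/subsetP=> a; rewrite inE => va.
have vg : connect r v g by have := subsetP GC g gG; rewrite inE.
by rewrite -[a \in G](closed_connect clG va) (closed_connect clG vg).
Qed.

(** * Growing a balanced set *)

Section Growth.

Variable B : {set V}.

(** For y outside B: c is a pendant at y in the graph without B. *)
Definition leaf_of (c y : V) : bool :=
  [&& c \notin B, e y c & [forall t, e c t ==> (t \in B) || (t == y)]].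

Hypothesis B_nbr : forall b y, b \in B -> exists z, [/\ e b z, z \notin B & z != y].
Hypothesis leaf_uniq :
  forall y c d, y \notin B -> leaf_of c y -> leaf_of d y -> c = d.

Lemma leaf_nbr c y t : leaf_of c y -> e c t -> t \notin B -> t = y.
Proof. by case/and3P=> _ _ /forallP/(_ t)/implyP lf /lf/orP[->|/eqP]. Qed.

(** What has to enter F with z. If z is not in B, then by [leaf_uniq] at most one
    leaf is added. *)
Definition cap (z : V) : {set V} := z |: [set c | leaf_of c z].

Lemma cap_root z : z \in cap z. Proof. by rewrite !inE eqxx. Qed.

Lemma cap_notB z c : z \notin B -> c \in cap z -> c \notin B.
Proof. by rewrite !inE => zB /orP[/eqP -> | /and3P[]]. Qed.

Lemma cap_connected z : connected_in (cap z).
Proof.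
apply: (@connected_in_root _ z) => c; case/setU1P=> [->|]; first exact: connect0.
rewrite inE => cz; apply: connect1; rewrite /restr !inE eqxx cz orbT.
by case/and3P: cz.
Qed.

Lemma cap_leaf z y c : z \notin B -> y \in cap z -> leaf_of c y -> c \in cap z.
Proof.
move=> zB; rewrite !inE => /orP[/eqP -> -> | yz cy]; first by rewrite orbT.
have /and3P[cB yc _] := cy.
by rewrite (leaf_nbr yz yc cB) eqxx.
Qed.

Lemma cap_degree z x : z \notin B -> x \in cap z -> #|nbhd_in e (cap z) x| <= 1.
Proof.
move=> zB xz; apply/card_le1_eqP=> a b.
rewrite !in_nbhd_in => /andP[az xa] /andP[bz xb].
case/setU1P: (xz) => [xE | ]; last first.
  rewrite inE => lx.
  by rewrite (leaf_nbr lx xa (cap_notB zB az)) (leaf_nbr lx xb (cap_notB zB bz)).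
move: az bz; rewrite !inE; subst x.
case/orP=> [/eqP E | la]; first by rewrite E irr_e in xa.
case/orP=> [/eqP E | lb]; first by rewrite E irr_e in xb.
exact: leaf_uniq lb la.
Qed.

(** A stage of the growth: F together with a connected set W, made of F and of
    the outside vertices that already have their two neighbours in F. By
    acyclicity a vertex outside W has at most one neighbour in W. Condition
    [pb_leaf] ensures that an outside vertex which is not in B and sees F has a
    further neighbour not in B. *)
Record partial_balanced (F W : {set V}) : Prop := PartialBalanced {
  pb_sub : F \subset W;
  pb_conn : connected_in W;
  pb_notB : {in F, forall x, x \notin B};
  pb_in : {in F, forall x, #|nbhd_in e F x| <= 1};
  pb_out : forall x, x \in W -> x \notin F -> #|nbhd_in e F x| = 2;
  pb_leaf : forall y c, y \in F -> leaf_of c y -> c \in F }.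

Lemma cap_partial_balanced z : z \notin B -> partial_balanced (cap z) (cap z).
Proof.
move=> zB; split=> //.
- exact: cap_connected.
- by move=> x; apply: cap_notB.
- by move=> x; apply: cap_degree.
- by move=> x ->.
- by move=> y c; apply: cap_leaf.
Qed.

(** W is enlarged by x and by the cap D of a second neighbour z of x. As W is
    connected, the edges xy and xz are the only ones between two of W, x and D,
    so degrees into F of old vertices and into D of new ones are unchanged. *)
Lemma partial_balanced_extend F W x y :
  partial_balanced F W -> x \notin W -> y \in F -> e x y ->
  exists F' W', [/\ partial_balanced F' W', F \subset F' & W \proper W'].
Proof.
case=> FW cW FB Fin Fout Fleaf xW yF xy; have yW := subsetP FW y yF.
have xF : x \notin F by apply: contra xW; apply: subsetP.
have [z [xz zB zy]] : exists z, [/\ e x z, z \notin B & z != y].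
  have [xB | xB] := boolP (x \in B); first exact: B_nbr.
  have: ~~ leaf_of x y by apply: contra xF; apply: Fleaf.
  rewrite /leaf_of xB sym_e xy /= => /forallPn[z].
  by rewrite negb_imply negb_or => /and3P[xz zB zy]; exists z.
have only_y w : w \in W -> e x w -> w = y.
  by move=> wW xw; apply: connected_in_nbr cW xW wW yW xw xy.
have cx : connected_in [set x].
  by move=> a b /set1P-> /set1P->.
have cWx : connected_in (W :|: [set x]).
  by apply: (connected_in_union cW cx yW (set11 x)); rewrite sym_e.
have zWx : z \notin W :|: [set x].
  rewrite !inE negb_or; apply/andP; split; apply/negP.
    by move=> zW; move: zy; rewrite (only_y z zW xz) eqxx.
  by move/eqP=> zx; rewrite zx irr_e in xz.
have xWx : x \in W :|: [set x] by rewrite !inE eqxx orbT.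
have cWxz : connected_in ((W :|: [set x]) :|: [set z]).
  apply: (connected_in_union cWx _ xWx (set11 z) xz).
  by move=> a b /set1P-> /set1P->.
have noz w : w \in W -> ~~ e z w.
  move=> wW; apply/negP=> zw; have zx : e z x by rewrite sym_e.
  have wWx : w \in W :|: [set x] by rewrite inE wW.
  by move: xW; rewrite -(connected_in_nbr cWx zWx wWx xWx zw zx) wW.
set D := cap z.
have xD : x \notin D.
  rewrite !inE negb_or; apply/andP; split.
    by apply/eqP=> E; rewrite E irr_e in xz.
  by apply/negP=> lx; rewrite (leaf_nbr lx xy (FB y yF)) eqxx in zy.
have DW c : c \in D -> [/\ c \notin W, (forall w, w \in W -> ~~ e c w)
                         & e x c -> c = z].
  case/setU1P=> [-> | cz].
    by split=> //; apply: contra zWx; rewrite inE => ->.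
  have cx' : c != x by apply: contraNneq xD => <-; rewrite inE cz orbT.
  rewrite inE in cz; have /and3P[cB zc _] := cz.
  have cz' : c != z by apply/eqP=> E; rewrite E irr_e in zc.
  have cW0 : c \notin W by apply/negP=> /noz; rewrite zc.
  have cWxz' : c \notin (W :|: [set x]) :|: [set z].
    by rewrite !inE (negPf cW0) (negPf cx') (negPf cz').
  have c_only w : w \in (W :|: [set x]) :|: [set z] -> e c w -> w = z.
    move=> wW cw; apply: (connected_in_nbr cWxz cWxz' wW _ cw); last by rewrite sym_e.
    by rewrite !inE eqxx orbT.
  split=> // [w wW | xc].
    apply/negP=> /c_only wz; case/negP: zWx.
    by rewrite -wz !inE wW.
  have zx : x = z by apply: c_only; rewrite ?inE ?eqxx ?orbT // sym_e.
  by rewrite -zx irr_e in xz.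
have nbhdW w : w \in W -> nbhd_in e (F :|: D) w = nbhd_in e F w.
  move=> wW; apply/setP=> t; rewrite !in_nbhd_in in_setU; case tF: (t \in F) => //=.
  apply/negP=> /andP[tD wt]; have [_ /(_ w wW)] : _ := DW t tD.
  by rewrite sym_e wt.
have nbhdD c : c \in D -> nbhd_in e (F :|: D) c = nbhd_in e D c.
  move=> cD; have [_ noW _] := DW c cD; apply/setP=> t.
  rewrite !in_nbhd_in in_setU; case tF: (t \in F) => //=.
  by rewrite (negPf (noW t (subsetP FW t tF))) andbF.
have nbhdx : nbhd_in e (F :|: D) x = [set y; z].
  apply/setP=> t; rewrite in_nbhd_in in_setU in_set2.
  apply/idP/idP=> [/andP[/orP[tF | tD] xt] | /orP[] /eqP->].
  - by rewrite (only_y t) ?eqxx // (subsetP FW).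
  - by have [_ _ ->] := DW t tD; rewrite ?eqxx ?orbT.
  - by rewrite yF xy.
  - by rewrite cap_root orbT xz.
exists (F :|: D), (W :|: (x |: D)); split; last 2 first.
- exact: subsetUl.
- rewrite properE subsetUl; apply/subsetPn; exists x => //.
  by rewrite !inE eqxx orbT.
have cxD : connected_in (x |: D).
  exact: connected_in_union cx (@cap_connected z) (set11 x) (cap_root z) xz.
split.
- by rewrite setUSS // subsetUr.
- apply: (connected_in_union cW cxD yW (setU11 x D)); by rewrite sym_e.
- by move=> t /setUP[/FB // |]; apply: cap_notB.
- move=> t /setUP[tF | tD]; first by rewrite nbhdW ?Fin // (subsetP FW).
  by rewrite nbhdD // cap_degree.
- move=> t tW'; rewrite in_setU negb_or => /andP[tF tD].
  case/setUP: tW' => [tW | /setU1P[-> | tD']].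
  + by rewrite nbhdW // Fout.
  + by rewrite nbhdx cards2 eq_sym zy.
  + by rewrite tD' in tD.
- move=> a c /setUP[aF | aD] ca; rewrite in_setU.
    by rewrite (Fleaf a).
  by rewrite (cap_leaf zB aD ca) orbT.
Qed.

Lemma balanced_exists v : v \notin B -> exists2 F, balanced F & v \in F.
Proof.
move=> vB.
suff grow n F W : #|~: W| < n -> partial_balanced F W -> v \in F ->
    exists2 F', balanced F' & v \in F'.
  exact: grow (ltnSn _) (cap_partial_balanced vB) (cap_root v).
elim: n F W => // n IHn F W Wn pbF vF.
have [/exists_inP[x xW /exists_inP[y yF xy]] | full] :=
    boolP [exists x in ~: W, exists y in F, e x y].
  rewrite inE in xW.
  have [F' [W' [pbF' FF' WW']]] := partial_balanced_extend pbF xW yF xy.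
  apply: IHn pbF' (subsetP FF' v vF); rewrite -ltnS.
  by apply: leq_trans Wn; rewrite ltnS; apply: proper_card; rewrite properC.
exists F => // x; case: ifP => xF; first exact: pb_in pbF _ xF.
have [xW | xW] := boolP (x \in W); first by rewrite (pb_out pbF) ?xF.
rewrite cards_eq0; apply/orP; left; apply/eqP/setP=> y; rewrite in_nbhd_in in_set0.
apply/negP=> /andP[yF xy]; case/negP: full.
by apply/exists_inP; exists x; rewrite ?inE //; apply/exists_inP; exists y.
Qed.

End Growth.

(** * The set of all B-vertices *)

Lemma B_graph_stable : exists n, B_graph e n.+1 = B_graph e n.
Proof.
suff drop m n : #|B_graph e n| < m -> exists n, B_graph e n.+1 = B_graph e n.
  exact: drop 0 (ltnSn _).
elim: m n => // m IHm n nm.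
have [|neqG] := eqVneq (B_graph e n.+1) (B_graph e n); first by exists n.
apply: (IHm n.+1); rewrite -ltnS; apply: leq_trans nm; rewrite ltnS proper_card //.
by rewrite properEneq neqG B_graph_antitone.
Qed.

(** The union of the first n layers; once the pruning is stationary from n on,
    it is the set of all B-vertices. *)
Definition B_set (n : nat) : {set V} :=
  [set x | [exists i : 'I_n, x \in B_layer e (B_graph e i)]].

Lemma B_setP n x :
  reflect (exists2 i, i < n & x \in B_layer e (B_graph e i)) (x \in B_set n).
Proof.
rewrite inE; apply: (iffP existsP) => [[i xi] | [i ilt xi]]; first by exists i.
by exists (Ordinal ilt).
Qed.

Lemma B_vertex_B_set n x : x \in B_set n -> B_vertex e x.
Proof. by case/B_setP=> i _; exists i. Qed.

Lemma remaining_not_B_set n x : x \in B_graph e n -> x \notin B_set n.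
Proof.
move=> xn; apply/negP=> /B_setP[i lt_in /B_layer_removed/negP[]].
exact: subsetP (B_graph_antitone lt_in) _ xn.
Qed.

Lemma stable_layer n : B_graph e n.+1 = B_graph e n -> B_layer e (B_graph e n) = set0.
Proof.
move=> stab; apply/setP=> x; rewrite in_set0; apply/negP=> xL.
have := B_layer_removed xL; rewrite stab.
by move: xL; rewrite inE => /andP[->].
Qed.

(** The two pendants of b at stage i are not B-vertices: they survive up to G_i
    and are removed together with b, so they could only be in layer i, which
    their degree one in G_i excludes. *)
Lemma B_set_nbr n b y :
  b \in B_set n -> exists z, [/\ e b z, z \notin B_set n & z != y].
Proof.
case/B_setP=> i lt_in bL.
have [u [w [uw uG wG Nu Nw]]] := B_layer_double_pendant bL.
have outside a : a \in B_graph e i -> nbhd_in e (B_graph e i) a = [set b] ->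
    e b a /\ a \notin B_set n.
  move=> aG Na; have /andP[_ ab] : (b \in B_graph e i) && e a b.
    by rewrite -in_nbhd_in Na set11.
  have ba : e b a by rewrite sym_e.
  split=> //; apply/negP=> /B_setP[j _ aL].
  have aGj : a \in B_graph e j by move: aL; rewrite inE => /andP[].
  case: (ltngtP i j) => ij.
  - have aS : a \in B_graph e i.+1 := subsetP (B_graph_antitone ij) _ aGj.
    case/setDP: aS => _ /negP[]; rewrite in_setU inE /pendant aG Na cards1 /=.
    by apply/orP; right; apply/exists_inP; exists b.
  - have /negP[] := B_layer_removed aL.
    exact: subsetP (B_graph_antitone ij) _ aG.
  (* a would have two distinct neighbours in G_i, whereas it has only b *)
  - subst j; have [p [q [pq pG qG Np Nq]]] := B_layer_double_pendant aL.
    have toB t : t \in B_graph e i -> nbhd_in e (B_graph e i) t = [set a] -> t = b.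
      move=> tG Nt; apply/set1P; rewrite -Na in_nbhd_in tG sym_e.
      by have := set11 a; rewrite -Nt in_nbhd_in => /andP[].
    by rewrite (toB p) // (toB q) // eqxx in pq.
have [bu uB] := outside u uG Nu; have [bw wB] := outside w wG Nw.
have [uy | uy] := eqVneq u y; last by exists u.
by exists w; rewrite bw wB -uy eq_sym uw.
Qed.

(** None of y, c, d is ever removed, because a removed vertex that is not a
    B-vertex has only B-vertices as neighbours. So c and d would be a double
    pendant at y in the stationary graph, whose layer is empty. *)
Lemma B_set_leaf_uniq n y c d :
  B_graph e n.+1 = B_graph e n -> y \notin B_set n ->
  leaf_of (B_set n) c y -> leaf_of (B_set n) d y -> c = d.
Proof.
move=> stab yB lc ld; apply/eqP/negPn/negP=> cd.
have remaining a b : a \notin B_set n -> b \notin B_set n -> e a b ->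
    a \in B_graph e n.
  move=> aB bB ab; apply/negPn/negP=> an.
  have aL i : i < n -> a \notin B_layer e (B_graph e i).
    by move=> lt_in; apply: contra aB => aL; apply/B_setP; exists i.
  have [i lt_in bL] := nbr_of_removed an aL ab.
  by case/B_setP: bB; exists i.
have pend a : leaf_of (B_set n) a y ->
    pendant e (B_graph e n) a /\ nbhd_in e (B_graph e n) a = [set y].
  move=> la; have /and3P[aB ya _] := la; have ay : e a y by rewrite sym_e.
  have Na : nbhd_in e (B_graph e n) a = [set y].
    apply/setP=> t; rewrite in_nbhd_in in_set1.
    apply/andP/eqP=> [[tn at_] | ->]; last by split=> //; apply: remaining yB aB ya.
    exact: leaf_nbr la at_ (remaining_not_B_set tn).
  by split=> //; rewrite /pendant Na cards1 (remaining a y).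
have [pc Nc] := pend c lc; have [pd Nd] := pend d ld.
have /and3P[cB yc _] := lc.
have: y \in B_layer e (B_graph e n).
  rewrite inE (remaining y c) //; apply/existsP; exists c; apply/existsP; exists d.
  by rewrite cd pc pd Nc Nd !eqxx.
by rewrite stable_layer // inE.
Qed.

Lemma irrelevant_B_vertex v : irrelevant e v <-> B_vertex e v.
Proof.
split=> [irr_v | [i vL]]; last first.
  apply/negPn/irrelevantPn=> -[F minF vF].
  by have := B_layer_notin_minset_fort minF vL; rewrite vF.
have [n stab] := B_graph_stable.
apply: (@B_vertex_B_set n); apply: contraTT irr_v => vB.
have leaf_uniq y c d := @B_set_leaf_uniq n y c d stab.
have [F balF vF] := balanced_exists (@B_set_nbr n) leaf_uniq vB.
by apply/irrelevantPn; apply: balanced_minset_fort balF vF.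
Qed.

End Forest.

Theorem theorem2p16 (V : finType) (e : rel V) (v : V) (tree_e : is_tree e) :
  irrelevant e v <-> B_vertex e v.
Proof.
by case: tree_e => -[sym_e irr_e] _ acyclic_e; apply: irrelevant_B_vertex.
Qed.
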